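(* Assume the ABC Conjecture over $\mathbb{Z}$. There is an absolute constant $c>0$ such that the following holds. Let $N>0$ be an integer and let $E_N$ be the elliptic curve $y^2=x^3-Nx$ over $\mathbb{Q}$. Let $Q_1\in E_N(\mathbb{Q})$ be a non-torsion point with $x(Q_1)<0$. (1) For every nonzero integer $n$ with $L(nQ_1)\le 1$, we have $h_O(nQ_1)\le c\log N$. (2) Let $Q_2\in E_N(\mathbb{Q})$ be such that $Q_1,Q_2$ are linearly independent (no relation $aQ_1+bQ_2=O$ with integers $(a,b)\ne(0,0)$). Assume moreover that either $Q_2=2R$ for some $R\in E_N(\mathbb{Q})$, or $x(Q_2)$ is the square of a rational number. Let $G=\langle Q_1,Q_2\rangle=\{n_1Q_1+n_2Q_2: n_1,n_2\in\mathbb{Z}\}$. Then for every $Q\in G$ with $Q\neq O$ and $L(Q)\le 1$ we have $h_O(Q)\le c\log N$.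
   Context: ABC Conjecture over $\mathbb{Z}$: for every $\epsilon>0$ there is a constant $K_\epsilon$ such that for all coprime integers $a,b,c$ with $a+b=c$ one has $\max(|a|,|b|,|c|)\le K_\epsilon\,\mathrm{rad}(abc)^{1+\epsilon}$, where $\mathrm{rad}(m)$ is the product of the distinct primes dividing $m$. The constant $c$ may depend on the constants $K_\epsilon$ of the ABC Conjecture, but not on $N$, the points, or the integers $n,n_1,n_2$. $O$ denotes the point at infinity. For a rational point $Q\ne O$, $h_O(Q)=\max\{0,\log|x(Q)|\}$. For a rational point $Q\ne O$ on an elliptic curve in Weierstrass form over $\mathbb{Q}$, the length $L(Q)$ is the number of distinct primes $p$ with $|x(Q)|_p>1$, where $|\cdot|_p$ is the usual $p$-adic absolute value. Equivalently, write $x(Q)=A_Q/B_Q^2$ in lowest terms; then $L(Q)$ is the number of distinct prime divisors of $B_Q$. *)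

(* Defs.v *)
From HB Require Import structures.
From mathcomp Require Import all_boot all_order all_algebra.
From Stdlib Require Import Reals.
Set Implicit Arguments. Unset Strict Implicit. Unset Printing Implicit Defensive.
Import Order.TTheory GRing.Theory Num.Theory.

Section Curve.
Local Open Scope ring_scope.

(* None = point at infinity O *)
Definition point := option (rat * rat).

Definition on_curve (N : nat) (P : point) : bool :=
  match P with
  | None => true
  | Some (x, y) => y ^+ 2 == x ^+ 3 - (N%:R) * x
  end.

Definition ec_neg (P : point) : point :=
  match P with None => None | Some (x, y) => Some (x, - y) end.

Definition ec_add (N : nat) (P Q : point) : point :=
  match P, Q with
  | None, _ => Q
  | _, None => P
  | Some (x1, y1), Some (x2, y2) =>
      if x1 == x2 then
        if y1 == - y2 then None
        else let l := (3%:R * x1 ^+ 2 - N%:R) / (2%:R * y1) in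
             let x3 := l ^+ 2 - x1 - x2 in
             Some (x3, l * (x1 - x3) - y1)
      else let l := (y2 - y1) / (x2 - x1) in
           let x3 := l ^+ 2 - x1 - x2 in
           Some (x3, l * (x1 - x3) - y1)
  end.

Fixpoint ec_muln (N : nat) (n : nat) (P : point) : point :=
  match n with
  | 0%N => None
  | n'.+1 => ec_add N P (ec_muln N n' P)
  end.

Definition ec_mul (N : nat) (n : int) (P : point) : point :=
  match n with
  | Posz k => ec_muln N k P
  | Negz k => ec_neg (ec_muln N k.+1 P)
  end.

Definition x_neg (P : point) : bool :=
  match P with None => false | Some (x, _) => x < 0 end.

Definition x_is_square (P : point) : Prop :=
  match P with None => False | Some (x, _) => exists r : rat, x = r ^+ 2 end.

(* length L(P): number of distinct primes dividing the denominator of x(P)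
   (x = A/B^2 in lowest terms, denq x = B^2 has the same prime divisors as B);
   L(O) := 0 by convention (never used). *)
Definition length_L (P : point) : nat :=
  match P with None => 0%N | Some (x, _) => size (primes (absz (denq x))) end.

End Curve.

Definition int_to_R (z : int) : R :=
  match z with
  | Posz n => INR n
  | Negz n => Ropp (INR n.+1)
  end.

Definition rat_to_R (q : rat) : R := Rdiv (int_to_R (numq q)) (int_to_R (denq q)).

(* h_O(Q) = max{0, log |x(Q)|}; h_O(O) := 0 (never used) *)
Definition h_O (P : point) : R :=
  match P with
  | None => 0%R
  | Some (x, _) => Rmax 0 (ln (Rabs (rat_to_R x)))
  end.

(* radical of a natural number: product of distinct prime divisors (rad 0 = 1) *)
Definition rad (n : nat) : nat := \prod_(p <- primes n) p.

Definition ABC_conjecture : Prop :=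
  forall eps : R, (0 < eps)%R ->
  exists K : R,
    forall a b c : int,
      coprimez a b -> coprimez b c -> coprimez a c ->
      @eq int (GRing.add a b) c ->
      (INR (maxn (absz a) (maxn (absz b) (absz c))) <=
         K * Rpower (INR (rad (absz (GRing.mul (GRing.mul a b) c)))) (1 + eps))%R.

(* Main.v *)
Require Import Defs.
From Stdlib Require Import Reals Lra.
From HB Require Import structures.
From mathcomp Require Import all_boot all_order all_algebra.
From mathcomp Require Import zify ring.
Import Order.TTheory GRing.Theory Num.Theory.
Set Implicit Arguments. Unset Strict Implicit. Unset Printing Implicit Defensive.

(** The map [P |-> x(P)] modulo nonzero squares, with [O |-> 1] and
    [(0, 0) |-> -N], is a homomorphism, and a class is negative exactly when
    [x(P) <= 0]. Since the class of [Q2] is trivial, [Q = n1 Q1 + n2 Q2] has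
    [x(Q) <= 0] for odd [n1], whence [|x(Q)| <= N]; for even [n1] the abscissa
    of [Q] is a square [(a / B)^2], and the equation of the curve becomes
    [(a^2 - b) (a^2 + b) = N B^4]. When [B] is a prime power, it is nearly coprime
    to one of the two factors, so that [u B^4 + 2 v = 4 a^2] with [u v = 2 N].
    As [B] is [O(a^(1/2))], the radical of this sum is [O(N a^(3/2))], and ABC
    bounds [a] by a power of [N]. For [N = 1] the right-hand side [c log N]
    vanishes, and Fermat's theorem on [a^4 - B^4 = b^2] is needed instead. *)

(** * Abscissae modulo rational squares *)

Section SquareClass.
Local Open Scope ring_scope.
Implicit Types (N : nat) (P Q : point) (p q : rat).

(** The descent map of the 2-torsion point [(0, 0)]: as [y^2 = x (x^2 - N)], [x] and [x^2 - N] agree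
    modulo squares where [y != 0], and the latter is [-N] at [x = 0]. Equality of two classes is
    expressed by their product being a nonzero square. *)
Definition sqclass N P : rat :=
  if P is Some (x, _) then (if x == 0 then - N%:R else x) else 1.

Definition issq q : Prop := exists2 r : rat, r != 0 & q = r ^+ 2.

Lemma issqM p q : issq p -> issq q -> issq (p * q).
Proof. by move=> [r r0 ->] [s s0 ->]; exists (r * s); rewrite ?mulf_neq0 ?exprMn. Qed.

Lemma issq_sqr q : q != 0 -> issq (q ^+ 2).
Proof. by exists q. Qed.

Lemma issq_gt0 q : issq q -> 0 < q.
Proof. by case=> r r0 ->; rewrite exprn_even_gt0. Qed.

Lemma issqMl p q : issq p -> issq (p * q) -> issq q.
Proof.
case=> r r0 -> [s s0 e]; exists (s / r); rewrite ?mulf_neq0 ?invr_neq0 //.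
by rewrite expr_div_n -e mulrAC mulfV ?mul1r // expf_neq0.
Qed.

Lemma sqclass_neq0 N P : (0 < N)%N -> sqclass N P != 0.
Proof.
move=> N0; case: P => [[x y]|] //=.
by case: ifPn => // _; rewrite oppr_eq0 pnatr_eq0 -lt0n.
Qed.

(* Vieta's formulas for [X^3 - l^2 X^2 - (N + 2 l m) X - m^2], whose roots are
   the abscissae of the intersection of the curve with [Y = l X + m]. *)
Lemma ec_add_vieta N (x1 y1 x2 y2 x3 y3 : rat) :
    on_curve N (Some (x1, y1)) -> on_curve N (Some (x2, y2)) ->
    ec_add N (Some (x1, y1)) (Some (x2, y2)) = Some (x3, y3) ->
  exists l m : rat,
    [/\ x1 + x2 + x3 = l ^+ 2,
        x1 * x2 + x1 * x3 + x2 * x3 = - N%:R - 2%:R * l * m,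
        x1 * x2 * x3 = m ^+ 2 & y3 = - (l * x3 + m)].
Proof.
rewrite /on_curve => /eqP h1 /eqP h2 add3.
(* This formula for [N] is the difference of the two curve equations divided by [x2 - x1]; it also
   holds for the tangent, so both cases reduce to polynomial identities. *)
suff [l [n_eq -> ->]] : exists l : rat,
    [/\ N%:R = x1 ^+ 2 + x1 * x2 + x2 ^+ 2 - l * (2%:R * y1 + l * (x2 - x1)),
        x3 = l ^+ 2 - x1 - x2 & y3 = l * (x1 - x3) - y1].
  rewrite n_eq in h1.
  exists l, (y1 - l * x1); rewrite {}n_eq; split; try ring.
  by rewrite sqrrB h1; ring.
move: add3 => /=; have [e|ne] := eqVneq x1 x2.
  subst x2; case: ifPn => // ny [] <- <-.
  have ey : y1 = y2.
    have : (y1 - y2) * (y1 + y2) = 0 by rewrite -subr_sqr h1 h2 subrr.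
    move/eqP; rewrite mulf_eq0 subr_eq0 addr_eq0 (negPf ny) orbF.
    by move/eqP.
  subst y2; have y0 : y1 != 0.
    by apply: contraNneq ny => ->; rewrite oppr0.
  by eexists; split; [|reflexivity..]; field.
case=> <- <-; have d0 : x2 - x1 != 0 by rewrite subr_eq0 eq_sym.
eexists; split; [|reflexivity..]; apply: (mulfI d0).
have -> : (x2 - x1) * N%:R = x2 ^+ 3 - x1 ^+ 3 - (y2 ^+ 2 - y1 ^+ 2).
  by rewrite h1 h2; ring.
by field.
Qed.

Lemma on_curve_add N P Q : on_curve N P -> on_curve N Q -> on_curve N (ec_add N P Q).
Proof.
case: P Q => [[x1 y1]|] [[x2 y2]|] // h1 h2.
case e: (ec_add N _ _) => [[x3 y3]|] //.
have [l [m [s1 s2 s3 ->]]] := ec_add_vieta h1 h2 e.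
rewrite /= sqrrN.
have -> : N%:R = - (x1 * x2 + x1 * x3 + x2 * x3) - 2%:R * l * m by rewrite s2; ring.
have -> : (l * x3 + m) ^+ 2 = l ^+ 2 * x3 ^+ 2 + 2%:R * l * m * x3 + m ^+ 2 by ring.
by rewrite -s1 -s3; apply/eqP; ring.
Qed.

Lemma on_curve0 N (y : rat) : on_curve N (Some (0, y)) -> y = 0.
Proof. by rewrite /= mulr0 expr0n subr0 /= => /eqP /eqP; rewrite sqrf_eq0 => /eqP. Qed.

(** When the line has intercept [m != 0], the three abscissae multiply to [m^2]. When [m = 0],
    exactly one abscissa vanishes and the other two multiply to [-N], so the value [-N] at the
    vanishing one makes the product [N^2]. *)
Lemma sqclass_add N P Q : (0 < N)%N -> on_curve N P -> on_curve N Q ->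
  issq (sqclass N P * sqclass N Q * sqclass N (ec_add N P Q)).
Proof.
move=> N0; have n0 : N%:R != 0 :> rat by rewrite pnatr_eq0 -lt0n.
case: P Q => [[x1 y1]|] [[x2 y2]|] h1 h2; rewrite ?mul1r ?mulr1 -?expr2;
  try by apply/issq_sqr/sqclass_neq0.
  2: by exists 1; rewrite ?expr1n.
case e: (ec_add N _ _) => [[x3 y3]|]; last first.
  rewrite mulr1; move: e => /=; case: eqVneq => [->|//] _.
  by rewrite -expr2; apply/issq_sqr/(@sqclass_neq0 N (Some (x2, y2))).
have [l [m [s1 s2 s3 _]]] := ec_add_vieta h1 h2 e.
have m0 : (x1 == 0) || (x2 == 0) || (x3 == 0) = (m == 0).
  by rewrite -!mulf_eq0 s3 sqrf_eq0.
have [m_eq0|m_neq0] := eqVneq m 0; last first.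
  move: m0; rewrite (negPf m_neq0) => /negbT; rewrite !negb_or => /andP[/andP[z1 z2] z3].
  by rewrite /= (negPf z1) (negPf z2) (negPf z3) s3; apply: issq_sqr.
move: m0 s2; rewrite m_eq0 eqxx mulr0 subr0 => m0 s2.
suff -> : sqclass N (Some (x1, y1)) * sqclass N (Some (x2, y2)) * sqclass N (Some (x3, y3))
          = N%:R ^+ 2 by apply: issq_sqr.
have no_two (a b c : rat) :
    a * b + a * c + b * c = - N%:R -> a == 0 -> (b == 0) = false /\ (c == 0) = false.
  move=> + /eqP a0; rewrite a0 !mul0r !add0r => bc.
  have : ~~ ((b == 0) || (c == 0)) by rewrite -mulf_eq0 bc oppr_eq0.
  by case/norP => /negPf -> /negPf ->.
rewrite /=; case: (eqVneq x1 0) m0 => [z1 _|z1].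
  have [|-> ->] := no_two x1 x2 x3 s2; first exact/eqP.
  by move: s2; rewrite z1 !mul0r !add0r -mulrA => ->; ring.
case: (eqVneq x2 0) => [z2 _|z2 /= z3].
  have [||_ ->] := no_two x2 x1 x3; [by rewrite -s2; ring | exact/eqP |].
  by move: s2; rewrite z2 !mulr0 !mul0r !add0r !addr0 mulrAC => ->; ring.
by rewrite z3; move: s2; rewrite (eqP z3) !mulr0 !addr0 => ->; ring.
Qed.

Lemma on_curve_mul N (n : int) P : on_curve N P -> on_curve N (ec_mul N n P).
Proof.
move=> hP; have hn k : on_curve N (ec_muln N k P).
  by elim: k => //= k IH; apply: on_curve_add.
case: n => k //=; have := hn k.+1 => /=.
by case: (ec_add _ _ _) => [[x y]|] //=; rewrite sqrrN.
Qed.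

Lemma sqclass_neg N P : sqclass N (ec_neg P) = sqclass N P.
Proof. by case: P => [[x y]|]. Qed.

(** Classes have exponent two, so only the parity of [n] matters. *)
Lemma sqclass_mul N (n : int) P : (0 < N)%N -> on_curve N P ->
  issq (sqclass N P ^+ odd `|n|%N * sqclass N (ec_mul N n P)).
Proof.
move=> N0 hP; have cP := sqclass_neq0 P N0.
have on_n k : on_curve N (ec_muln N k P) := @on_curve_mul N (Posz k) P hP.
have hn k : issq (sqclass N P ^+ odd k * sqclass N (ec_muln N k P)).
  elim: k => [|k IH]; first by rewrite mul1r; exists 1; rewrite ?expr1n.
  have := issqM IH (sqclass_add N0 hP (on_n k)).
  set c := sqclass N P; set d := sqclass N (ec_muln N k P) => h.
  have hd : issq (d ^+ 2) by apply/issq_sqr/sqclass_neq0.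
  rewrite /=; case: (odd k) h => /= h.
    apply: (@issqMl (c ^+ 2 * d ^+ 2)); first exact/issqM/hd/issq_sqr.
    by congr issq: h; rewrite /c /d; ring.
  by apply: (@issqMl (d ^+ 2)) => //; congr issq: h; rewrite /c /d; ring.
case: n => k; first exact: hn.
by rewrite /ec_mul sqclass_neg; apply: hn.
Qed.
End SquareClass.

(** * Pythagorean triples and Fermat's quartic equation *)

Section NatArithmetic.
Implicit Types (a b c g k m n p s t w x y z : nat).

(** With [g = gcdn m k], [m = m' g] and [k = k' g], one gets [m' n = g k'^2]; coprimality makes [m']
    and [g] divide each other, so [m = g^2]. *)
Lemma coprime_mul_sqr m n k : coprime m n -> m * n = k ^ 2 -> exists s, m = s ^ 2.
Proof.
move=> cmn mn; have [m0|m_gt0] := posnP m; first by exists 0.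
exists (gcdn m k); have g_gt0 : 0 < gcdn m k by rewrite gcdn_gt0 m_gt0.
move: (dvdn_gcdl m k) (dvdn_gcdr m k) => /dvdnP[m' em] /dvdnP[k' ek].
have cmk : coprime m' k'.
  by rewrite /coprime -(eqn_pmul2r g_gt0) muln_gcdl -em -ek mul1n.
move: g_gt0 em ek; set g := gcdn m k => g_gt0 em ek.
have e : m' * n = g * k' ^ 2.
  by apply/eqP; rewrite -(eqn_pmul2l g_gt0); apply/eqP; nia.
have cgn : coprime g n by apply: coprime_dvdl cmn; rewrite em dvdn_mull.
have mg : m' %| g by rewrite -(@Gauss_dvdl _ _ (k' ^ 2)) ?coprimeXr // -e dvdn_mulr.
have gm : g %| m' by rewrite -(@Gauss_dvdl _ _ n) // e dvdn_mulr.
have -> : g ^ 2 = g * g by [].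
by rewrite {1}em; congr muln; apply/eqP; rewrite eqn_dvd mg gm.
Qed.

(** The left side is 2 modulo 4. *)
Lemma sum_odd_sqr_neq a b c : odd a -> odd b -> a ^ 2 + b ^ 2 <> c ^ 2.
Proof.
move=> oa ob; rewrite -(odd_double_half a) -(odd_double_half b) oa ob.
by rewrite -(odd_double_half c); case: (odd c) => /=; nia.
Qed.

(** The halves of [c + a] and [c - a] are coprime with product [(b / 2)^2], so each is a square. *)
Lemma pythagorean_param a b c :
    coprime a b -> odd a -> ~~ odd b -> a ^ 2 + b ^ 2 = c ^ 2 ->
  exists m n, [/\ a + n ^ 2 = m ^ 2, b = 2 * (m * n), c = m ^ 2 + n ^ 2 & coprime m n].
Proof.
move=> cab oa eb e.
have oc : odd c.
  by have := congr1 odd e; rewrite oddD !oddX /= oa (negPf eb).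
have le_ac : a <= c by rewrite -leq_sqr -e leq_addr.
pose s := (c - a)./2; pose t := (c + a)./2.
have es : c = a + 2 * s.
  have : ~~ odd (c - a) by rewrite oddB // oc oa.
  by rewrite /s => h; have := odd_double_half (c - a); rewrite (negPf h); lia.
have et : a + s = t by rewrite /t es; lia.
have [w ew] : exists w, b = 2 * w.
  by exists b./2; have := odd_double_half b; rewrite (negPf eb); lia.
have ts : t * s = w ^ 2 by move: e; rewrite es -et ew; nia.
have cts : coprime t s.
  have dvd_a d : d %| t -> d %| s -> d %| a.
    by move=> dt ds; rewrite -(dvdn_addl _ ds) et.
  have dvd_w : gcdn t s ^ 2 %| w ^ 2.
    by rewrite -ts dvdn_mul ?dvdn_gcdl ?dvdn_gcdr.
  rewrite /coprime -dvdn1 -(eqP cab) dvdn_gcd dvd_a ?dvdn_gcdl ?dvdn_gcdr //.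
  by rewrite ew dvdn_mull // -(@dvdn_pexp2r _ _ 2).
have [m em] := coprime_mul_sqr cts ts.
have [n en] : exists n, s = n ^ 2.
  by apply: (@coprime_mul_sqr s t w); rewrite 1?coprime_sym // mulnC.
exists m, n; split; [lia | | lia |].
  rewrite ew; congr muln; apply/eqP; rewrite -eqn_sqr; apply/eqP.
  by rewrite -ts em en expnMn.
by move: cts; rewrite em en coprime_pexpl ?coprime_pexpr.
Qed.

(** Here [m = 2 s^2] and [n = t^2]. Parametrizing the triple [(n, m, x)] by [u] and [v] gives
    [u v = s^2], so [u = p^2], [v = q^2] and [p^4 = q^4 + t^2], with [p <= u^2 < x]. *)
Lemma fermat_descent x m n w :
    coprime m n -> ~~ odd m -> 0 < m -> 0 < n -> m * n = 2 * w ^ 2 ->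
    x ^ 2 = m ^ 2 + n ^ 2 ->
  exists x' y' z', [/\ x' < x, 0 < y', 0 < z' & x' ^ 4 = y' ^ 4 + z' ^ 2].
Proof.
move=> cmn em m_gt0 n_gt0 mn xx.
have [m1 em1] : exists m1, m = 2 * m1.
  by exists m./2; have := odd_double_half m; rewrite (negPf em); lia.
have cm1n : coprime m1 n by apply: coprime_dvdl cmn; rewrite em1 dvdn_mull.
have m1n : m1 * n = w ^ 2 by move: mn; rewrite em1; lia.
have [s es] := coprime_mul_sqr cm1n m1n.
have [t et] : exists t, n = t ^ 2.
  by apply: (@coprime_mul_sqr n m1 w); rewrite 1?coprime_sym // mulnC.
have on : odd n.
  by apply: contraTT cmn => on; rewrite em1 coprimeMl coprime2n (negPf on).
have [||||u [v [uv1 uv2 uv3 cuv]]] := @pythagorean_param n m x; rewrite 1?coprime_sym //.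
  by rewrite addnC.
have uvs : u * v = s ^ 2 by move: uv2; rewrite em1 es; lia.
have [p ep] := coprime_mul_sqr cuv uvs.
have [q eq] : exists q, v = q ^ 2.
  by apply: (@coprime_mul_sqr v u s); rewrite 1?coprime_sym // mulnC.
have uv_gt0 : 0 < u * v by move: m_gt0; rewrite uv2 muln_gt0.
have [u_gt0 v_gt0] : 0 < u /\ 0 < v by move: uv_gt0; rewrite muln_gt0 => /andP.
exists p, q, t; split.
- have le_sqr k : k <= k ^ 2 by case: k => // k; rewrite -[leqLHS]expn1 leq_pexp2l.
  apply: leq_ltn_trans (le_sqr p) _; rewrite -ep; apply: leq_ltn_trans (le_sqr u) _.
  by rewrite uv3 -[ltnLHS]addn0 ltn_add2l expn_gt0 v_gt0.
- by move: v_gt0; rewrite eq; case: (q).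
- by move: n_gt0; rewrite et; case: (t).
by rewrite (expnM p 2 2) -ep -uv1 et eq -expnM addnC.
Qed.

(** Infinite descent on [x], through the triple with legs [y^2], [z] and hypotenuse [x^2]. For odd
    [y] its parameters satisfy [m^4 = n^4 + (x y)^2] with [m < x]; for even [y], [m n] is twice a
    square and [fermat_descent] applies. *)
Lemma fermat_quartic x y z : 0 < y -> 0 < z -> x ^ 4 <> y ^ 4 + z ^ 2.
Proof.
elim/ltn_ind: x y z => x IH y z y_gt0 z_gt0 e.
have x_gt0 : 0 < x.
  by rewrite -(ltn_exp2r _ _ (isT : 0 < 4)) e addn_gt0 expn_gt0 y_gt0.
(* If [g] divides [x] and [y], then [g^2] divides [z], and dividing out gives a smaller solution. *)
have [cxy|ncxy] := boolP (coprime x y); last first.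
  set g := gcdn x y; have g_gt0 : 0 < g by rewrite gcdn_gt0 x_gt0.
  have g_gt1 : 1 < g by rewrite ltn_neqAle eq_sym ncxy g_gt0.
  move: (dvdn_gcdl x y) (dvdn_gcdr x y) => /dvdnP[x' ex] /dvdnP[y' ey].
  rewrite -/g in ex ey.
  have /dvdnP[z' ez] : g ^ 2 %| z.
    rewrite -(@dvdn_pexp2r _ _ 2) // -expnM -(@dvdn_addr (y ^ 4)); last first.
      by rewrite ey expnMn dvdn_mull.
    by rewrite -e ex expnMn dvdn_mull.
  apply: (IH x' _ y' z').
  - by rewrite [ltnRHS]ex ltn_Pmulr //; move: x_gt0; rewrite ex muln_gt0 => /andP[].
  - by move: y_gt0; rewrite ey; case: (y').
  - by move: z_gt0; rewrite ez; case: (z').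
  apply/eqP; rewrite -(@eqn_pmul2r (g ^ 4)) ?expn_gt0 ?g_gt0 // mulnDl -!expnMn -ex -ey.
  by rewrite e ez expnMn -expnM.
have cyz : coprime y z.
  have : coprime (y ^ 4) (x ^ 4) by rewrite coprimeXl // coprimeXr // coprime_sym.
  by rewrite e /coprime gcdnDl -/(coprime _ _) coprime_pexpl ?coprime_pexpr.
have e4 k : k ^ 4 = (k ^ 2) ^ 2 by rewrite -expnM.
rewrite !e4 in e; have [oy|ey] := boolP (odd y).
  have ez : ~~ odd z.
    by apply/negP => oz; apply: (@sum_odd_sqr_neq (y ^ 2) z (x ^ 2)); rewrite ?oddX ?oy.
  have [||m [n [mn1 mn2 mn3 _]]] := @pythagorean_param (y ^ 2) z (x ^ 2) _ _ ez (esym e).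
  - by rewrite coprimeXl.
  - by rewrite oddX oy.
  have [m_gt0 n_gt0] : 0 < m /\ 0 < n.
    by move: z_gt0; rewrite mn2 !muln_gt0 => /andP[_ /andP].
  apply: (IH m _ n (x * y)); rewrite ?muln_gt0 ?x_gt0 //.
    by rewrite -ltn_sqr mn3 -[ltnLHS]addn0 ltn_add2l expn_gt0 n_gt0.
  by rewrite expnMn mn3 !e4 -mn1; lia.
have oz : odd z.
  apply: contraTT cyz => oz; rewrite /coprime; apply/eqP => g1.
  by have := dvdn_gcd 2 y z; rewrite g1 !dvdn2 ey oz.
have [|||m [n [mn1 mn2 mn3 cmn]]] := @pythagorean_param z (y ^ 2) (x ^ 2) _ oz.
- by rewrite coprimeXr // coprime_sym.
- by rewrite oddX /= (negPf ey).
- by rewrite addnC.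
have [w ew] : exists w, y = 2 * w.
  by exists y./2; have := odd_double_half y; rewrite (negPf ey); lia.
have mn : m * n = 2 * w ^ 2 by move: mn2; rewrite ew expnMn; lia.
have [m_gt0 n_gt0] : 0 < m /\ 0 < n.
  by apply/andP; rewrite -muln_gt0 mn; move: y_gt0; rewrite ew; case: (w).
suff [x' [y' [z' [ltx y0 z0 e']]]] :
    exists x' y' z', [/\ x' < x, 0 < y', 0 < z' & x' ^ 4 = y' ^ 4 + z' ^ 2].
  exact: IH ltx _ _ y0 z0 e'.
have [om|em] := boolP (odd m); last exact: fermat_descent mn mn3.
apply: (@fermat_descent x n m w); rewrite 1?coprime_sym 1?mulnC 1?addnC //.
by apply/negP => on; have := congr1 odd mn; rewrite !oddM om on.
Qed.

(** * Prime powers, radicals and the factored quartic *)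

(** For [k > 0], [p] does not divide [a], so the smaller of the valuations of [s] and [t] is at most
    that of 2; the factor 2 in the conclusion pays for [p = 2]. *)
Lemma prime_power_split p k a s t : prime p -> coprime a (p ^ k) ->
    0 < s -> 0 < t -> s + t = 2 * a ^ 2 -> p ^ (4 * k) %| s * t ->
  (p ^ (4 * k) %| 2 * s) || (p ^ (4 * k) %| 2 * t).
Proof.
case: k => [|k]; first by rewrite muln0 expn0 !dvd1n.
move=> p_pr; rewrite coprime_pexpr // coprime_sym => cpa s0 t0 st.
have aa0 : 0 < 2 * a ^ 2 by rewrite -st addn_gt0 s0.
have a0 : 0 < a ^ 2 by move: aa0; rewrite muln_gt0.
rewrite !pfactor_dvdn ?muln_gt0 ?s0 ?t0 // !lognM //.
have : p ^ (minn (logn p s) (logn p t)) %| 2 * a ^ 2.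
  rewrite -st dvdn_add // pfactor_dvdn // ?geq_minl ?geq_minr //.
by rewrite pfactor_dvdn // lognM // lognX (logn_coprime cpa) muln0; lia.
Qed.

Lemma prod_primes_dvdn (r : seq nat) m :
  uniq r -> {in r, forall p, prime p && (p %| m)} -> \prod_(p <- r) p %| m.
Proof.
elim: r => [|p r IH] /= => [_ _|/andP[pr ur] H]; first by rewrite big_nil dvd1n.
have /andP[p_pr pm] := H p (mem_head _ _).
have Hr q : q \in r -> prime q && (q %| m) by move=> qr; apply: H; rewrite inE qr orbT.
rewrite big_cons Gauss_dvd ?pm ?IH //.
rewrite big_seq; apply: (big_ind (coprime p)) => [|x y|q qr].
- exact: coprimen1.
- by rewrite coprimeMr => -> ->.
have /andP[q_pr _] := Hr q qr.
by rewrite prime_coprime // dvdn_prime2 //; apply: contraNneq pr => ->.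
Qed.

Lemma rad_leq n m : 0 < m -> (forall p, prime p -> p %| n -> p %| m) -> Defs.rad n <= m.
Proof.
move=> m_gt0 H; apply/dvdn_leq/prod_primes_dvdn => //; first exact: primes_uniq.
by move=> p; rewrite mem_primes => /and3P[p_pr _ pn]; rewrite p_pr H.
Qed.

Lemma rad_gt0 n : 0 < Defs.rad n.
Proof.
rewrite /Defs.rad big_seq; apply: (big_ind (leq 1)) => // [x y|p]; first by rewrite muln_gt0 => -> ->.
by rewrite mem_primes => /andP[/prime_gt0].
Qed.

Lemma primes_size1 n : 0 < n -> size (primes n) <= 1 -> exists p k, prime p /\ n = p ^ k.
Proof.
move=> n_gt0; have := prod_prime_decomp n_gt0; rewrite prime_decompE big_map.
case: (primes n) (@mem_primes ^~ n) => [|p [|//]] /= mem -> _.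
  (* Without prime divisors [n] is 1, taken as [2^0]. *)
  by exists 2, 0; rewrite big_nil.
exists p, (logn p n); rewrite big_seq1; split=> //.
by have := mem p; rewrite mem_head => /esym/and3P[].
Qed.

Lemma quartic_factor N a b p k : prime p -> 0 < N -> coprime a (p ^ k) ->
    a ^ 4 = N * (p ^ k) ^ 4 + b ^ 2 ->
  exists u v, u * v = 2 * N /\ u * (p ^ k) ^ 4 + 2 * v = 4 * a ^ 2.
Proof.
move=> p_pr N_gt0 cap; set B := p ^ k => e.
have B4 : B ^ 4 = p ^ (4 * k) by rewrite /B -expnM mulnC.
have B4_gt0 : 0 < B ^ 4 by rewrite B4 expn_gt0 prime_gt0.
(* Strict since [N > 0]; the truncated [a^2 - b] is thus exact and positive. *)
have lt_ba : b < a ^ 2.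
  by rewrite -ltn_sqr -expnM e -[ltnLHS]add0n ltn_add2r muln_gt0 N_gt0.
have st : (a ^ 2 - b) * (a ^ 2 + b) = N * B ^ 4.
  by rewrite -subn_sqr -expnM e addnK.
have sum : (a ^ 2 - b) + (a ^ 2 + b) = 2 * a ^ 2 by lia.
have t_gt0 : 0 < a ^ 2 + b by apply: leq_trans (leq_addr _ _); apply: leq_ltn_trans lt_ba.
have s_gt0 : 0 < a ^ 2 - b by rewrite subn_gt0.
move: st sum s_gt0 t_gt0; move: (a ^ 2 - b) (a ^ 2 + b) => s t st sum s_gt0 t_gt0.
have dvd : p ^ (4 * k) %| s * t by rewrite st B4 dvdn_mull.
have := prime_power_split p_pr cap s_gt0 t_gt0 sum dvd.
rewrite -B4; move: (B ^ 4) B4_gt0 st => D D_gt0 st.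
(* [u] is the cofactor of [B^4] in twice one factor, and [v] is the other factor. *)
case/orP=> /dvdnP[u eu]; [exists u, t | exists u, s]; rewrite -eu -mulnDr.
  split; last by rewrite sum mulnA.
  by apply/eqP; rewrite -(eqn_pmul2r D_gt0) mulnAC -eu -mulnA st mulnA.
split; last by rewrite addnC sum mulnA.
by apply/eqP; rewrite -(eqn_pmul2r D_gt0) mulnAC -eu -mulnA (mulnC t) st mulnA.
Qed.
End NatArithmetic.

(** * Numerators and denominators of rational points *)

Section RatSquares.
Local Open Scope ring_scope.

Lemma num_den_sqr (q : rat) : numq (q ^+ 2) = numq q ^+ 2 /\ denq (q ^+ 2) = denq q ^+ 2.
Proof.
have e : q ^+ 2 = (numq q ^+ 2)%:~R / (denq q ^+ 2)%:~R.
  by rewrite -{1}(divq_num_den q) expr_div_n !rmorphXn.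
have co : coprime `|(numq q ^+ 2)%R|%N `|(denq q ^+ 2)%R|%N.
  by rewrite !abszX coprimeXl // coprimeXr // coprime_num_den.
rewrite e coprimeq_num // coprimeq_den // sqrf_eq0 denq_eq0.
by rewrite gtr0_sg ?mul1r ?ger0_norm ?sqr_ge0 ?exprn_gt0 ?denq_gt0.
Qed.

(** With [B] the denominator and [a] the absolute numerator of [r], [w = y B^2 / r] has the integral
    square [a^4 - N B^4], so [w] is an integer and [b] is its absolute value. *)
Lemma square_point (N : nat) (r y : rat) : r != 0 ->
    on_curve N (Some (r ^+ 2, y)) ->
  exists a b B : nat, [/\ (0 < a)%N, (0 < B)%N, coprime a B,
    (a ^ 4 = N * B ^ 4 + b ^ 2)%N &
    `|numq (r ^+ 2)|%N = (a ^ 2)%N /\ `|denq (r ^+ 2)|%N = (B ^ 2)%N].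
Proof.
move=> r0 /eqP h; have [-> ->] := num_den_sqr r.
pose w := y / r * (denq r)%:~R ^+ 2.
have ew : w ^+ 2 = (numq r ^+ 4 - N%:R * denq r ^+ 4)%:~R.
  have -> : w ^+ 2 = (r ^+ 4 - N%:R) * (denq r)%:~R ^+ 4.
    by rewrite /w !exprMn h; field.
  by rewrite intrB intrM !rmorphXn /= numqE natz; ring.
have dw : denq w = 1.
  have [_] := num_den_sqr w; rewrite ew denq_int => /esym/eqP.
  by rewrite sqrf_eq1 => /orP[/eqP|/eqP e] //; have := denq_gt0 w; rewrite e.
have {ew} ew : numq w ^+ 2 = numq r ^+ 4 - N%:R * denq r ^+ 4.
  by apply: (@intr_inj rat); rewrite -ew rmorphXn /= numqE dw mulr1.
exists `|numq r|%N, `|numq w|%N, `|denq r|%N; split.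
- by rewrite absz_gt0 numq_eq0.
- by rewrite absz_gt0 denq_neq0.
- exact: coprime_num_den.
- apply: (can_inj absz_nat); have ev (z : int) k : ~~ odd k -> (`|z| ^ k)%N = z ^+ k :> int.
    by move=> ok; rewrite -abszX abszE ger0_norm // exprn_even_ge0.
  by rewrite PoszD PoszM !ev // ew natz; ring.
by rewrite !abszX.
Qed.

(* The bound is crude: [x < 0] even gives [x^2 <= N]. *)
Lemma nonpos_x_bound (N : nat) (x y : rat) : (0 < N)%N -> x <= 0 ->
  on_curve N (Some (x, y)) -> (`|numq x| <= N * `|denq x|)%N.
Proof.
move=> N_gt0 x_le0 /eqP h.
have le_xN : - x <= N%:R.
  rewrite leNgt; apply/negP => lt_Nx.
  have N1 : (1 : rat) <= N%:R by rewrite ler1n.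
  (* From [-x > N >= 1] follows [x^2 > N], which would make [y^2] negative. *)
  have : 0 < (- x) * (x ^+ 2 - N%:R).
    rewrite mulr_gt0 ?(lt_trans _ lt_Nx) ?ltr0n //.
    rewrite subr_gt0 -sqrrN (lt_le_trans lt_Nx) // expr2 ler_peMl ?oppr_ge0 //.
    exact/ltW/(le_lt_trans _ lt_Nx).
  have -> : - x * (x ^+ 2 - N%:R) = - y ^+ 2 by rewrite h; ring.
  by rewrite oppr_gt0 ltNge sqr_ge0.
rewrite -lez_nat PoszM !abszE normr_denq -(ler_int rat) rmorphM /= intr_norm numqE.
have den_ge0 : (0 : rat) <= (denq x)%:~R by rewrite ler0z denq_ge0.
by rewrite normrM (ler0_norm x_le0) (ger0_norm den_ge0) ler_wpM2r.
Qed.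
End RatSquares.

(** * Logarithmic heights and the ABC bound *)

Section Heights.
Local Open Scope R_scope.

Lemma INR_muln (m n : nat) : INR (m * n)%N = INR m * INR n.
Proof. exact: mult_INR. Qed.

Lemma INR_leq (m n : nat) : (m <= n)%N -> INR m <= INR n.
Proof. by move=> /ssrnat.leP; apply: le_INR. Qed.

Lemma INR_gt0 (n : nat) : (0 < n)%N -> 0 < INR n.
Proof. by move=> /ssrnat.leP; apply: lt_0_INR. Qed.

Lemma ln_le (x y : R) : 0 < x -> x <= y -> ln x <= ln y.
Proof. by move=> x_gt0 [xy|->]; [apply/Rlt_le/ln_increasing | lra]. Qed.

Lemma ln_INR_ge0 (n : nat) : (0 < n)%N -> 0 <= ln (INR n).
Proof. by move=> n_gt0; rewrite -ln_1; apply: ln_le; [lra | apply: (@INR_leq 1)]. Qed.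

Lemma ln_INRM (m n : nat) : (0 < m)%N -> (0 < n)%N ->
  ln (INR (m * n)%N) = ln (INR m) + ln (INR n).
Proof. by move=> m0 n0; rewrite INR_muln ln_mult //; apply: INR_gt0. Qed.

Lemma Rabs_int_to_R (z : int) : Rabs (int_to_R z) = INR `|z|%N.
Proof.
case: z => n; rewrite /int_to_R.
  by rewrite Rabs_pos_eq //; apply: pos_INR.
by rewrite Rabs_Ropp Rabs_pos_eq //; apply: pos_INR.
Qed.

Lemma h_O_le (x y : rat) (M : nat) : (0 < M)%N ->
  (`|numq x| <= M * `|denq x|)%N -> h_O (Some (x, y)) <= ln (INR M).
Proof.
move=> M_gt0 le_xM.
have d_gt0 : 0 < INR `|denq x|%N by apply: INR_gt0; rewrite absz_gt0 denq_neq0.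
have xM : Rabs (rat_to_R x) <= INR M.
  rewrite /rat_to_R /Rdiv Rabs_mult Rabs_inv !Rabs_int_to_R; apply: (Rmult_le_reg_r (INR `|denq x|%N)) => //.
  rewrite Rmult_assoc Rinv_l ?Rmult_1_r -?INR_muln; last lra.
  exact: INR_leq.
apply: Rmax_lub; first exact: ln_INR_ge0.
have [x_gt0|x0] := Rabs_pos (rat_to_R x); first exact: ln_le.
(* The logarithm of 0 is 0 by convention. *)
rewrite -x0 /ln; case: Rlt_dec => [/Rlt_irrefl //|_].
exact: ln_INR_ge0.
Qed.

Definition abc_with (eps K : R) : Prop :=
  forall a b c : int,
    coprimez a b -> coprimez b c -> coprimez a c -> (a + b = c)%R ->
    INR (maxn `|a| (maxn `|b| `|c|))%N
      <= K * Rpower (INR (Defs.rad `|(a * b * c)%R|%N)) (1 + eps).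

(* ABC for summands that need not be coprime: dividing by the gcd costs a factor
   at most [Y]. *)
Lemma abc_common_factor (eps K : R) (X Y Z M : nat) :
    0 < eps -> 0 <= K -> abc_with eps K ->
    (0 < X)%N -> (0 < Y)%N -> (X + Y = Z)%N -> (0 < M)%N ->
    (forall p, prime p -> (p %| X * Y * Z)%N -> (p %| M)%N) ->
  INR Z <= INR Y * (K * Rpower (INR M) (1 + eps)).
Proof.
move=> eps_gt0 K_ge0 abc X_gt0 Y_gt0 XYZ M_gt0 pM.
have g_gt0 : (0 < gcdn X Y)%N by rewrite gcdn_gt0 X_gt0.
have leg : (gcdn X Y <= Y)%N by rewrite dvdn_leq ?dvdn_gcdr.
move: (dvdn_gcdl X Y) (dvdn_gcdr X Y) => /dvdnP[X' eX] /dvdnP[Y' eY].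
have cXY : coprime X' Y'.
  by rewrite /coprime -(eqn_pmul2r g_gt0) muln_gcdl -eX -eY mul1n.
move: g_gt0 leg eX eY; set g := gcdn X Y => g_gt0 leg eX eY.
pose Z' := (X' + Y')%N; have eZ : Z = (Z' * g)%N by rewrite mulnDl -eX -eY XYZ.
have := abc (Posz X') (Posz Y') (Posz Z'); rewrite /coprimez /gcdz !absz_nat.
rewrite !eqz_nat => /(_ cXY) => H.
have {H} H : INR Z' <= K * Rpower (INR M) (1 + eps).
  apply: Rle_trans (INR_leq _) _; last first.
    apply: Rle_trans (H _ _ _) _.
    - by rewrite /Z' addnC gcdnDl gcdnC.
    - by rewrite /Z' gcdnDl.
    - by rewrite /Z' PoszD.
    apply: Rmult_le_compat_l => //; apply: Rle_Rpower_l; first lra.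
    split; first by apply/INR_gt0/rad_gt0.
    apply/INR_leq/rad_leq => // p p_pr pd.
    apply: pM => //; apply: dvdn_trans pd _.
    by rewrite eX eY eZ !dvdn_mul // dvdn_mulr.
  by rewrite leq_max leq_max leqnn !orbT.
rewrite eZ INR_muln Rmult_comm.
by apply: Rmult_le_compat => //; [exact: pos_INR | exact: pos_INR | exact: INR_leq].
Qed.

(** ABC gives [4 a^2 <= 4 N K M^(7/6)] with [M = 2 N B a] and [M^2 <= 8 N^2 a^3]. Hence
    [ln a / 4 <= 13/6 ln N + ln K + 7/4 ln 2], and [N >= 2] absorbs the constants: [13/6 + 7/4 < 4],
    while [ln K <= (ln K / ln 2) ln N]. *)
Lemma square_class_bound (K : R) (N a b B p k : nat) :
    1 <= K -> abc_with (1 / 6) K -> (1 < N)%N -> (0 < a)%N ->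
    prime p -> B = (p ^ k)%N -> coprime a B ->
    (a ^ 4 = N * B ^ 4 + b ^ 2)%N ->
  ln (INR (a ^ 2)%N) <= 8 * (4 + ln K / ln 2) * ln (INR N).
Proof.
move=> K1 abc N_gt1 a_gt0 p_pr eB caB e; have N_gt0 := ltnW N_gt1.
have B_gt0 : (0 < B)%N by rewrite eB expn_gt0 prime_gt0.
have [u [v [uv uB]]] : exists u v, (u * v = 2 * N)%N /\ (u * B ^ 4 + 2 * v = 4 * a ^ 2)%N.
  by move: caB e; rewrite eB => caB e; apply: quartic_factor e.
have /andP[u_gt0 v_gt0] : (0 < u)%N && (0 < v)%N by rewrite -muln_gt0 uv muln_gt0.
have leB : (B ^ 2 <= 2 * a)%N.
  rewrite -leq_sqr -expnM expnMn -uB; apply: leq_trans (leq_addr _ _).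
  by rewrite leq_pmull.
have M_gt0 : (0 < 2 * N * B * a)%N by rewrite !muln_gt0 N_gt0 B_gt0.
(* Squaring lets [B^2 <= 2 a] be used without a square root of [a]. *)
have leM : ((2 * N * B * a) * (2 * N * B * a) <= 8 * (N * N) * (a * a * a))%N.
  have -> : ((2 * N * B * a) * (2 * N * B * a) = (4 * (N * N) * (a * a)) * B ^ 2)%N by lia.
  have -> : (8 * (N * N) * (a * a * a) = (4 * (N * N) * (a * a)) * (2 * a))%N by lia.
  by rewrite leq_mul2l leB orbT.
have lev : (2 * v <= 4 * N)%N.
  have -> : (4 * N = 2 * (u * v))%N by rewrite uv mulnA.
  by rewrite leq_mul2l leq_pmull.
have K_gt0 : 0 < K by lra.
have bound : INR (4 * (a * a)) <= INR (4 * N) * (K * Rpower (INR (2 * N * B * a)) (1 + 1 / 6)).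
  apply: (Rle_trans _ (INR (2 * v) * (K * Rpower (INR (2 * N * B * a)) (1 + 1 / 6)))).
    apply: (@abc_common_factor _ _ (u * B ^ 4) (2 * v));
      rewrite ?muln_gt0 ?u_gt0 ?expn_gt0 ?B_gt0 ?N_gt0 ?a_gt0 //; try lra.
    (* As [u v = 2 N], a prime dividing one of the three terms divides [2 N B a]. *)
    move=> q q_pr; rewrite !Euclid_dvdM // => H.
    have quv : (q %| u)%N || (q %| v)%N -> (q %| 2)%N || (q %| N)%N.
      by rewrite -!Euclid_dvdM // uv.
    move: H quv.
    have -> : (q %| 4)%N = (q %| 2)%N by have := Euclid_dvdX 2 2 q_pr; rewrite andbT.
    by case: (q %| u)%N (q %| v)%N (q %| 2)%N (q %| N)%N (q %| B)%N (q %| a)%N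
      => [] [] [] [] [] [] //= _ /(_ isT).
  apply: Rmult_le_compat_r (INR_leq lev).
  by apply: Rmult_le_pos; [lra | apply/Rlt_le/exp_pos].
have {bound} := ln_le (INR_gt0 (_ : 0 < 4 * (a * a))%N) bound.
rewrite !muln_gt0 a_gt0 => /(_ isT).
rewrite ln_mult; [|by apply: INR_gt0; rewrite muln_gt0|by apply/Rmult_lt_0_compat/exp_pos].
rewrite (ln_mult K) //; last exact: exp_pos.
rewrite /Rpower ln_exp !(ln_INRM (m := 4)) ?muln_gt0 ?a_gt0 // => bound.
have := ln_le (INR_gt0 (_ : 0 < 2 * N * B * a * (2 * N * B * a))%N) (INR_leq leM).
rewrite muln_gt0 M_gt0 => /(_ isT).
rewrite (ln_INRM M_gt0 M_gt0) !(ln_INRM (m := 8 * (N * N)), ln_INRM (m := 8)) ?muln_gt0 ?N_gt0 ?a_gt0 //.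
move: bound; rewrite -mulnn !ln_INRM ?muln_gt0 ?a_gt0 ?N_gt0 //.
have -> : ln (INR 8) = 3 * ln 2.
  by rewrite -[8%N]/(2 * (2 * 2))%N !ln_INRM // (_ : INR 2 = 2) /=; lra.
have ln2 : 0 < ln 2 by rewrite -ln_1; apply: ln_increasing; lra.
have lnK : 0 <= ln K by rewrite -ln_1; apply: ln_le; lra.
have lnN : ln 2 <= ln (INR N).
  by apply: ln_le; [lra | apply: Rle_trans (INR_leq N_gt1) => /=; lra].
have lnKN : ln K <= ln K / ln 2 * ln (INR N).
  rewrite -{1}(Rmult_1_r (ln K)) /Rdiv Rmult_assoc; apply: Rmult_le_compat_l => //.
  by apply: (Rmult_le_reg_l (ln 2)) => //; rewrite -Rmult_assoc Rinv_r; lra.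
lra.
Qed.
End Heights.

(* From square classes to the height bound *)
Delimit Scope ring_scope with ring.
Delimit Scope R_scope with R.

Section MainTheorem.
Implicit Types (N : nat) (P Q : point).

Lemma ln_div_ln2_ge0 (K : R) : (1 <= K)%R -> (0 <= ln K / ln 2)%R.
Proof.
move=> K1; apply: Rmult_le_pos; first by rewrite -ln_1; apply: ln_le; lra.
by apply/Rlt_le/Rinv_0_lt_compat; rewrite -ln_1; apply: ln_increasing; lra.
Qed.

Lemma height_bound (K : R) N Q :
    (1 <= K)%R -> abc_with (1 / 6)%R K -> (0 < N)%N -> on_curve N Q -> Q <> None ->
    (sqclass N Q < 0)%ring \/ issq (sqclass N Q) -> (length_L Q <= 1)%N ->
  (h_O Q <= 8 * (4 + ln K / ln 2) * ln (INR N))%R.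
Proof.
move=> K1 abc N_gt0 Qon Q_neqO cQ lenQ; case: Q Qon Q_neqO cQ lenQ => // -[x y] Qon _ cQ lenQ.
have lnN := ln_INR_ge0 N_gt0.
have c_ge1 : (1 <= 8 * (4 + ln K / ln 2))%R by have := ln_div_ln2_ge0 K1; lra.
case: cQ => [cx|[r r0]].
  have x_le0 : (x <= 0)%ring.
    by move: cx => /=; case: eqVneq => [->//|_ /ltW].
  apply: Rle_trans (h_O_le y N_gt0 (nonpos_x_bound N_gt0 x_le0 Qon)) _.
  by rewrite -[X in (X <= _)%R]Rmult_1_l; apply: Rmult_le_compat_r.
(* At [x = 0] the class [-N] is negative, hence not a square. *)
rewrite /sqclass; case: eqVneq => [_ e|_ ex].
  have : (0 < - N%:R :> rat)%ring by rewrite e issq_gt0 //; exists r.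
  by rewrite oppr_gt0 ltrn0.
subst x; have [a [b [B [a_gt0 B_gt0 caB e [en ed]]]]] := square_point r0 Qon.
have [N_le1|N_gt1] := leqP N 1.
  have N1 : N = 1%N by apply/eqP; rewrite eqn_leq N_le1.
  (* Fermat's theorem leaves only [b = 0], so [x = 1], of height 0. *)
  have eaB : a = B.
    rewrite N1 mul1n in e; have [b0|b_gt0] := posnP b; last by have := fermat_quartic B_gt0 b_gt0 e.
    by apply/eqP; rewrite -(@eqn_exp2r _ _ 4) // e b0 addn0.
  rewrite N1 ln_1 Rmult_0_r -ln_1; apply: (@h_O_le _ _ 1) => //.
  by rewrite en ed eaB mul1n.
have [p [k [p_pr eB]]] : exists p k, prime p /\ B = (p ^ k)%N.
  by apply: primes_size1 => //; move: lenQ; rewrite /length_L ed primesX.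
apply: Rle_trans (square_class_bound K1 abc N_gt1 a_gt0 p_pr eB caB e).
by apply: h_O_le; rewrite ?expn_gt0 ?a_gt0 // en leq_pmulr // ed expn_gt0 B_gt0.
Qed.

(** [Q] has the class of [n1 Q1], which is trivial or that of [Q1] by the parity of [n1]; equality
    of classes preserves signs. *)
Lemma sqclass_comb N Q1 Q2 (n1 n2 : int) :
    (0 < N)%N -> on_curve N Q1 -> on_curve N Q2 ->
    x_neg Q1 -> issq (sqclass N Q2) ->
  let Q := ec_add N (ec_mul N n1 Q1) (ec_mul N n2 Q2) in
  (sqclass N Q < 0)%ring \/ issq (sqclass N Q).
Proof.
move=> N_gt0 on1 on2 neg1 sq2 Q.
have c1 : (sqclass N Q1 < 0)%ring.
  by case: Q1 neg1 {on1 Q} => [[x y]|] //= x_lt0; rewrite lt_eqF.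
have sq2n : issq (sqclass N (ec_mul N n2 Q2)).
  apply: issqMl (sqclass_mul n2 N_gt0 on2).
  by case: odd => //=; exists 1%ring; rewrite ?expr1n.
have sq12 := sqclass_add N_gt0 (on_curve_mul n1 on1) (on_curve_mul n2 on2).
have {}sq12 : issq (sqclass N (ec_mul N n1 Q1) * sqclass N Q)%ring.
  by apply: (issqMl sq2n); congr issq: sq12; ring.
have := sqclass_mul n1 N_gt0 on1; case: odd => /= h; last first.
  by right; apply: issqMl sq12; move: h; rewrite expr0 mul1r.
left; have := issq_gt0 h; rewrite expr1 nmulr_rgt0 // => c1n.
by have := issq_gt0 sq12; rewrite nmulr_rgt0.
Qed.

Lemma ec_add0 N P : ec_add N P None = P.
Proof. by case: P => [[]|]. Qed.

End MainTheorem.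

Theorem theorem1p2 :
  ABC_conjecture ->
  exists c : R, (0 < c)%R /\
  forall (N : nat), (0 < N)%N ->
  forall Q1 : point,
    on_curve N Q1 ->
    (forall n : int, n <> Posz 0 -> ec_mul N n Q1 <> None) ->
    x_neg Q1 ->
    (* (1) *)
    (forall n : int, n <> Posz 0 -> (length_L (ec_mul N n Q1) <= 1)%N ->
        (h_O (ec_mul N n Q1) <= c * ln (INR N))%R) /\
    (* (2) *)
    (forall Q2 : point,
        on_curve N Q2 ->
        (forall a b : int,
            ec_add N (ec_mul N a Q1) (ec_mul N b Q2) = None ->
            a = Posz 0 /\ b = Posz 0) ->
        ((exists R0 : point, on_curve N R0 /\ Q2 = ec_add N R0 R0)
         \/ x_is_square Q2) ->
        forall Q : point,
          (exists n1 n2 : int, Q = ec_add N (ec_mul N n1 Q1) (ec_mul N n2 Q2)) ->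
          Q <> None ->
          (length_L Q <= 1)%N ->
          (h_O Q <= c * ln (INR N))%R).
Proof.
(* The exponent [3/2 (1 + eps)] of [a] must stay below 2; [eps = 1/6] gives [7/4]. *)
move=> ABC; have [|K0 abc0] := ABC (1 / 6)%R; first lra.
(* Raising the constant to at least 1 makes [ln K] nonnegative. *)
pose K := Rmax 1 K0; have K1 : (1 <= K)%R by apply: Rmax_l.
have abc : abc_with (1 / 6) K.
  move=> a b c ab bc ac abc; apply: Rle_trans (abc0 a b c ab bc ac abc) _.
  by apply: Rmult_le_compat_r; [apply/Rlt_le/exp_pos | apply: Rmax_r].
exists (8 * (4 + ln K / ln 2))%R; split; first by have := ln_div_ln2_ge0 K1; lra.
move=> N N_gt0 Q1 on1 tors1 neg1; split.
  move=> n n0; apply: height_bound => //; [exact: on_curve_mul | exact: tors1 |].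
  (* Part (1) is the combination with [Q2 = O], whose class is 1. *)
  have := @sqclass_comb N Q1 None n 0%ring N_gt0 on1 isT neg1.
  by rewrite [ec_mul N 0 None]/= ec_add0; apply; exists 1%ring; rewrite ?expr1n.
move=> Q2 on2 indep sq Q [n1 [n2 eQ]] QO; apply: height_bound => //.
  by rewrite eQ; apply: on_curve_add; apply: on_curve_mul.
rewrite eQ; apply: sqclass_comb => //.
case: sq => [[P [onP eP]]|].
  (* The class of a double is the square of a class. *)
  rewrite eP; apply: issqMl (sqclass_add N_gt0 onP onP).
  by rewrite -expr2; apply/issq_sqr/sqclass_neq0.
case: Q2 {eQ} on2 indep => [[x y]|] // on2 indep [r ex].
have [x0|x0] := eqVneq x 0%ring; last first.
  by rewrite /= (negPf x0); exists r => //; apply: contraNneq x0 => r0; rewrite ex r0 expr0n.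
(* Here [Q2 = (0, 0)] has order two, and [0 Q1 + 2 Q2 = O] contradicts independence. *)
subst x; rewrite x0 in on2 indep; have y0 := on_curve0 on2; subst y.
by have [] := indep 0%ring 2%ring; rewrite //= eqxx oppr0 eqxx.
Qed.
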